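(* Let $n\geq3$. There is no strictly monotone function $\Psi\colon[0,\infty)\to\mathbb{R}$ such that the mapping $$F\mapsto W(F)=\Psi(\|\mathrm{dev}_n\log V\|^2),\qquad V=\sqrt{FF^T},$$ is rank-one convex on $\mathrm{GL}^+(n)$.
   Context: $\mathrm{GL}^+(n)$ is the group of real $n\times n$ matrices with positive determinant. For $F\in\mathrm{GL}^+(n)$, $V=\sqrt{FF^T}$ is the positive definite symmetric square root of $FF^T$, $\log V$ is its principal matrix logarithm, $\mathrm{dev}_nX=X-\frac1n\,\mathrm{tr}(X)\,\mathrm{Id}$ is the deviatoric (trace-free) part of $X\in\mathbb{R}^{n\times n}$ (with $\mathrm{Id}$ the identity matrix), and $\|X\|^2=\mathrm{tr}(XX^T)$ is the squared Frobenius norm. For $\xi,\eta\in\mathbb{R}^n$, $(\xi\otimes\eta)_{ij}=\xi_i\eta_j$. A function $W\colon\mathrm{GL}^+(n)\to\mathbb{R}$ is called rank-one convex if for all $F\in\mathrm{GL}^+(n)$, all $\xi,\eta\in\mathbb{R}^n$ and any interval $I\subset\mathbb{R}$ such that $\det(F+t\,\xi\otimes\eta)>0$ for all $t\in I$, the mapping $I\to\mathbb{R}$, $t\mapsto W(F+t\,\xi\otimes\eta)$ is convex. *)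

(* Defs.v *)
From HB Require Import structures.
From mathcomp Require Import all_boot all_order all_algebra.
From mathcomp Require Import complex.
From mathcomp Require Import all_classical all_reals all_analysis.

Set Implicit Arguments.
Unset Strict Implicit.
Unset Printing Implicit Defensive.

Import Order.TTheory GRing.Theory Num.Theory.
Import numFieldNormedType.Exports.

Local Open Scope classical_set_scope.
Local Open Scope ring_scope.

Section MatrixFunctions.
Variables (R : realType) (n : nat).
Implicit Types A F V X : 'M[R]_n.

Definition posdefmx A : Prop :=
  A^T = A /\ forall x : 'cV[R]_n, x != 0 -> 0 < (x^T *m A *m x) 0 0.

(* For positive definite A the set below is a singleton; the value 0 is only
   taken when A has no positive definite square root. *)
Definition sqrtmx A : 'M[R]_n :=
  xget 0 [set V | posdefmx V /\ V *m V = A].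

Definition expmx X : 'M[R]_n :=
  limn (series (fun k : nat => (k`!%:R : R)^-1 *: X ^+ k)).

(* The logarithm of A all of whose complex eigenvalues lie in the open strip
   -pi < Im z < pi. It exists and is unique whenever A has no eigenvalue in
   the closed negative half-line, in particular for positive definite A. *)
Definition is_principal_log A X : Prop :=
  expmx X = A /\
  forall z : R[i], eigenvalue (map_mx (real_complex R) X) z ->
    `|complex.Im z| < pi.

Definition logmx A : 'M[R]_n := xget 0 [set X | is_principal_log A X].

Definition devmx X : 'M[R]_n := X - (n%:R^-1 * \tr X)%:M.

Definition frobenius_sq X : R := \tr (X *m X^T).

Definition left_stretch F : 'M[R]_n := sqrtmx (F *m F^T).

(* W stands for a function on GL^+(n): only its values at matrices of positive
   determinant are involved. *)
Definition rank_one_convex (W : 'M[R]_n -> R) : Prop :=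
  forall (F : 'M[R]_n) (xi eta : 'cV[R]_n) (I : set R),
    0 < \det F -> is_interval I ->
    (forall t, I t -> 0 < \det (F + t *: (xi *m eta^T))) ->
    convex_function (I : set (convex_lmodType R^o))
      (fun t : R^o => W (F + (t : R) *: (xi *m eta^T))).

End MatrixFunctions.

(* Strictly increasing, or strictly decreasing, on [0, +oo). *)
Definition strictly_monotone_nneg (R : realType) (Psi : R -> R) : Prop :=
  {in `[0, +oo[ &, {homo Psi : x y / x < y}} \/
  {in `[0, +oo[ &, {homo Psi : x y /~ x < y}}.

(* Main.v *)
Require Import Defs.
From mathcomp Require Import all_boot all_order all_algebra.
From mathcomp Require Import complex ring lra.
From mathcomp Require Import all_classical all_reals all_analysis.

Set Implicit Arguments.
Unset Strict Implicit.
Unset Printing Implicit Defensive.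

Import Order.TTheory GRing.Theory Num.Theory.
Import numFieldNormedType.Exports.

Local Open Scope classical_set_scope.
Local Open Scope ring_scope.

(** Along a rank-one line, convexity of [Psi (g t)] with [Psi] strictly
increasing forbids an interior point where [g] is larger than at two points
around it; with [Psi] strictly decreasing it forbids an interior point where
[g] is smaller than at two points around it. So it is enough to exhibit one
line of each kind for [g t = ||dev log V||^2].

Both are found among the rank-one lines
[[
  F(t) = diag (G(t), e^c, ..., e^c),   G(t) = [1+t, t k; 0, 1],
]]
on which [det G] is affine in [t]. If [e^a, e^b] are the singular values of
[G(t)], then [e^a e^b = 1 + t], [|e^a - e^b| = |t| sqrt (1 + k^2)], and
[[
  g t = (a - b)^2 / 2 + K (a + b - 2 c)^2,   K = (n - 2) / (2 n) > 0,
]]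
which is [shear_energyP].

- Decreasing case: with [k = c = 0], [g] vanishes at [t = 0] and is positive
  for every other [t > -1].
- Increasing case: up to an additive constant, the second term of [g] is
  [K s^2 - 4 K c s] with [s = a + b = ln (1 + t)], and [s] takes the values
  [0, ln 2, 2 ln 2] at [t = 0, 1, 3]. The parameter [c] is free because
  [n >= 3]. For large [k] the gap [|a - b|] is [2 ln k] up to a bounded error
  at both [t = 1] and [t = 3], so [(a - b)^2 / 2] rises by about [2 (ln k)^2]
  from [t = 0] to [t = 1] but only by a multiple of [ln k] from [t = 1] to
  [t = 3], whereas [- 4 K c s] falls by the same amount both times. Choosing
  that amount between the two rises gives [g 0 < g 1 > g 3]: this is
  [shear_energy_interior_max], with [k = 32] and [4 K c = 36 ln 2].

What remains is to evaluate the square root and the logarithm, that is, to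
show that [left_stretch] and [logmx] act on the eigenvalues of an orthogonally
diagonalised matrix. For the square root this is the uniqueness of positive
definite roots, [posdef_sqrt_unique]. For the logarithm the competitor [X] is
an arbitrary real matrix, and the argument is [principal_log_diag_unique]:
[X] commutes with [exp X = diag (e^l)], hence also with [diag l]; on each
eigenspace of [diag l] a nonreal eigenvalue of [X] in the strip would rotate a
plane that [exp X] only dilates, and a Jordan block of [X] would shear a plane
that [exp X] only dilates. Hence [X - diag l] is nilpotent without Jordan
blocks, that is, zero. *)

(** * The matrix exponential, entry by entry *)

Section MatrixExponential.
Variable R : realType.

Lemma cvg_mx_entries m n (u : nat -> 'M[R]_(m, n)) (L : 'M[R]_(m, n)) :
  (forall i j, (fun k => u k i j) @ \oo --> L i j) -> u @ \oo --> L.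
Proof.
move=> uL A /= [P PL PA].
have uP (ij : 'I_m * 'I_n) : \forall k \near \oo, P ij.1 ij.2 (u k ij.1 ij.2).
  exact: uL (PL _ _).
rewrite nbhs_filterE /=; near=> k.
have Pk : forall ij : 'I_m * 'I_n, P ij.1 ij.2 (u k ij.1 ij.2).
  by near: k; exact: filter_forall.
by apply: PA => i j; exact: (Pk (i, j)).
Unshelve. all: by end_near.
Qed.

Lemma cvg_lincomb n (s : 'I_n -> R^nat) (a c : 'I_n -> R) :
  (forall l, s l @ \oo --> a l) ->
  (fun m => \sum_l s l m * c l) @ \oo --> \sum_l a l * c l.
Proof.
move=> sa; elim: n s a c sa => [|n IH] s a c sa.
  rewrite big_ord0 (_ : (fun _ => _) = cst 0); first exact: cvg_cst.
  by apply/funext => m; rewrite big_ord0.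
rewrite big_ord_recr (_ : (fun _ => _) = fun m =>
    \sum_(l < n) s (widen_ord (leqnSn n) l) m * c (widen_ord (leqnSn n) l)
    + s ord_max m * c ord_max); last by apply/funext => m; rewrite big_ord_recr.
by apply: cvgD; [apply: IH => l | apply: cvgMr_tmp]; exact: sa.
Qed.

Definition mx_sum_norm n (X : 'M[R]_n) : R := \sum_i \sum_j `|X i j|.

Lemma expr_mx_entry_le n (X : 'M[R]_n) k i j :
  `|(X ^+ k) i j| <= mx_sum_norm X ^+ k.
Proof.
elim: k i j => [|k IH] i j.
  by rewrite !expr0 mxE; case: (i == j); rewrite ?normr1 ?normr0.
rewrite !exprS mxE (le_trans (ler_norm_sum _ _ _))//.
apply: (@le_trans _ _ (\sum_l `|X i l| * mx_sum_norm X ^+ k)).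
  by apply: ler_sum => l _; rewrite normrM ler_wpM2l.
rewrite -mulr_suml ler_wpM2r//.
  by apply: exprn_ge0; apply: sumr_ge0 => a _; apply: sumr_ge0.
rewrite /mx_sum_norm [leRHS](bigD1 i)//= lerDl.
by apply: sumr_ge0 => a _; apply: sumr_ge0.
Qed.

(** A geometric bound on [a] survives shifts of the index only up to the
constant [C], which is why [C] is there. *)
Lemma cvg_series_geom_fact (a : R^nat) (C K : R) :
  (forall k, `|a k| <= C * K ^+ k) ->
  cvgn (series (fun k => (k`!%:R)^-1 * a k)).
Proof.
move=> aK; apply: normed_cvg.
have cvgC : cvgn (series (fun k => `|C| * exp_coeff `|K| k)).
  exact: is_cvg_seriesZ (is_cvg_series_exp_coeff `|K|).
apply: series_le_cvg cvgC => [k|k|k] //=.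
  by rewrite /exp_coeff/= mulr_ge0// divr_ge0// exprn_ge0.
rewrite /exp_coeff/= normrM ger0_norm ?invr_ge0// mulrC mulrA ler_wpM2r ?invr_ge0//.
by rewrite (le_trans (aK k))// -normrX -normrM ler_norm.
Qed.

(** Since [expmx] is a limit in the space of matrices, its value means something
only once the series converges, which holds for every [X]. *)
Lemma cvg_expmx_entry n (X : 'M[R]_n) i j :
  series (fun k => (k`!%:R)^-1 * (X ^+ k) i j) @ \oo --> expmx X i j.
Proof.
pose L := \matrix_(i, j) limn (series (fun k => (k`!%:R)^-1 * (X ^+ k) i j)).
have XL : series (fun k => (k`!%:R : R)^-1 *: X ^+ k) @ \oo --> L.
  apply: cvg_mx_entries => a b; rewrite mxE.
  rewrite (_ : (fun _ => _) = series (fun k => (k`!%:R)^-1 * (X ^+ k) a b)).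
    by apply: (cvg_series_geom_fact (C := 1) (K := mx_sum_norm X)) => k;
      rewrite mul1r expr_mx_entry_le.
  by apply/funext => m; rewrite /series/= summxE; apply: eq_bigr => ? _; rewrite mxE.
rewrite /expmx (cvg_lim _ XL)//= mxE.
by apply: (cvg_series_geom_fact (C := 1) (K := mx_sum_norm X)) => k;
  rewrite mul1r expr_mx_entry_le.
Qed.

Lemma cvg_row_expmx n (u : 'rV[R]_n) (X : 'M[R]_n) j :
  series (fun k => (k`!%:R)^-1 * (u *m X ^+ k) 0 j) @ \oo --> (u *m expmx X) 0 j.
Proof.
rewrite mxE; under eq_bigr do rewrite mulrC.
rewrite (_ : series _ = fun m =>
    \sum_i series (fun k => (k`!%:R)^-1 * (X ^+ k) i j) m * u 0 i).
  by apply: cvg_lincomb => i; exact: cvg_expmx_entry.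
apply/funext => m; rewrite /series/=.
under [RHS]eq_bigr do rewrite mulr_suml.
rewrite exchange_big/=; apply: eq_bigr => k _.
rewrite mxE mulr_sumr; apply: eq_bigr => i _; ring.
Qed.

(** All values of [expmx] below are obtained by computing the rows
[u *m X ^+ k] and summing. *)
Lemma row_expmx_unique n (u w : 'rV[R]_n) (X : 'M[R]_n) :
  (forall j, series (fun k => (k`!%:R)^-1 * (u *m X ^+ k) 0 j) @ \oo --> w 0 j) ->
  u *m expmx X = w.
Proof.
move=> H; apply/rowP => j.
by rewrite -(cvg_lim _ (H j))// -(cvg_lim _ (@cvg_row_expmx _ u X j)).
Qed.

Lemma cvg_expR (x : R) :
  series (fun k => (k`!%:R)^-1 * x ^+ k) @ \oo --> expR x.
Proof.
rewrite (_ : (fun _ => _) = exp_coeff x); last by rewrite exp_coeffE.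
exact: is_cvg_series_exp_coeff.
Qed.

Lemma expmx_conj n (P Q X : 'M[R]_n) : Q *m P = 1%:M ->
  expmx (P *m X *m Q) = P *m expmx X *m Q.
Proof.
move=> QP; have PQ := mulmx1C QP.
have XE k : (P *m X *m Q) ^+ k = P *m X ^+ k *m Q.
  elim: k => [|k IH]; first by rewrite !expr0 mulmx1 PQ.
  rewrite !exprS IH -[_ * _]/(_ *m _) -[X * _]/(_ *m _) !mulmxA.
  by rewrite -(mulmxA _ Q P) QP mulmx1.
apply/row_matrixP => i; rewrite !rowE; set e : 'rV[R]_n := delta_mx 0 i.
apply: row_expmx_unique => j.
rewrite (_ : (e *m (P *m expmx X *m Q)) 0 j =
   \sum_l (e *m P *m expmx X) 0 l * Q l j); last by rewrite !mulmxA mxE.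
rewrite (_ : series _ = fun m =>
    \sum_l (series (fun k => (k`!%:R)^-1 * (e *m P *m X ^+ k) 0 l) m) * Q l j).
  by apply: cvg_lincomb => l; exact: cvg_row_expmx.
apply/funext => m; rewrite /series/=.
under [RHS]eq_bigr do rewrite mulr_suml.
rewrite exchange_big/=; apply: eq_bigr => k _.
by rewrite XE !mulmxA mxE mulr_sumr; apply: eq_bigr => l _; rewrite mulrA.
Qed.

Lemma expmx_diag n (l : 'rV[R]_n) :
  expmx (diag_mx l) = diag_mx (map_mx (@expR R) l).
Proof.
have lX k i : delta_mx 0 i *m diag_mx l ^+ k = (l 0 i ^+ k) *: delta_mx 0 i :> 'rV_n.
  elim: k => [|k IH]; first by rewrite !expr0 mulmx1 scale1r.
  rewrite exprSr -[_ * _]/(_ *m _) mulmxA IH -scalemxAl -rowE row_diag_mx scalerA.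
  by rewrite exprSr.
apply/row_matrixP => i; rewrite !rowE; apply: row_expmx_unique => j.
rewrite -rowE row_diag_mx !mxE.
rewrite (_ : series _ = fun m =>
    (series (fun k => (k`!%:R)^-1 * l 0 i ^+ k) m) * (delta_mx 0 i : 'rV[R]_n) 0 j).
  rewrite mxE; apply: cvgMr_tmp; exact: cvg_expR.
apply/funext => m; rewrite /series/= mulr_suml; apply: eq_bigr => k _.
by rewrite lX mxE mulrA.
Qed.

Lemma expmx_comm n (X : 'M[R]_n) : X *m expmx X = expmx X *m X.
Proof.
apply/row_matrixP => i; rewrite !rowE !mulmxA; set e : 'rV[R]_n := delta_mx 0 i.
apply: row_expmx_unique => j; rewrite mxE.
rewrite (_ : series _ = fun m =>
    \sum_l (series (fun k => (k`!%:R)^-1 * (e *m X ^+ k) 0 l) m) * X l j).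
  by apply: cvg_lincomb => l; exact: cvg_row_expmx.
apply/funext => m; rewrite /series/=.
under [RHS]eq_bigr do rewrite mulr_suml.
rewrite exchange_big/=; apply: eq_bigr => k _.
rewrite -mulmxA -[X *m _]/(X * _) -exprS exprSr -[_ ^+ _ * _]/(_ *m _) mulmxA.
rewrite mxE mulr_sumr.
by apply: eq_bigr => l _; rewrite mulrA.
Qed.

End MatrixExponential.

(** * The complex exponential in real coordinates *)

Section ComplexExponential.
Variable R : realType.
Variables x y : R.

(** Real and imaginary parts of [(x + i y) ^ k]. *)
Fixpoint cpow (k : nat) : R * R :=
  if k is k'.+1 then
    let: (a, b) := cpow k' in (x * a - y * b, x * b + y * a)
  else (1, 0).

Lemma cpow_le k : `|(cpow k).1| + `|(cpow k).2| <= (`|x| + `|y|) ^+ k.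
Proof.
elim: k => [|k IH]; first by rewrite /= normr1 normr0 addr0.
rewrite exprS /=; case: (cpow k) IH => a b /= IH.
apply: le_trans (_ : (`|x| + `|y|) * (`|a| + `|b|) <= _);
  last by rewrite ler_wpM2l// addr_ge0.
have := ler_normB (x * a) (y * b); have := ler_normD (x * b) (y * a).
rewrite !normrM; nra.
Qed.

Lemma cpow1_le k : `|(cpow k).1| <= (`|x| + `|y|) ^+ k.
Proof. by apply: le_trans (cpow_le k); rewrite lerDl. Qed.

Lemma cpow2_le k : `|(cpow k).2| <= (`|x| + `|y|) ^+ k.
Proof. by apply: le_trans (cpow_le k); rewrite lerDr. Qed.

(** The exponential generating function of [a]: differentiating it shifts [a],
which turns the recurrence of [cpow] into a differential equation. *)
Definition egf (a : R^nat) (t : R) : R :=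
  limn (pseries (fun k => (k`!%:R)^-1 * a k) t).

Lemma is_cvg_egf (a : R^nat) (C K t : R) :
  (forall k, `|a k| <= C * K ^+ k) ->
  cvgn (pseries (fun k => (k`!%:R)^-1 * a k) t).
Proof.
move=> aK; rewrite /pseries.
rewrite (_ : (fun _ => _) = (fun k => (k`!%:R)^-1 * (a k * t ^+ k))).
  apply: (cvg_series_geom_fact (C := C) (K := K * `|t|)) => k.
  by rewrite normrM normrX exprMn mulrA ler_wpM2r.
by apply/funext => k; rewrite mulrA.
Qed.

Lemma pseries_diffs_egf (a : R^nat) :
  pseries_diffs (fun k => (k`!%:R)^-1 * a k) = (fun k => (k`!%:R)^-1 * a k.+1).
Proof.
apply/funext => k; rewrite /pseries_diffs factS natrM invfM mulrA [X in X * _]mulrA.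
by rewrite mulfV ?mul1r.
Qed.

Lemma is_derive_egf (a : R^nat) (C K t : R) :
  (forall k, `|a k| <= C * K ^+ k) ->
  is_derive t (1 : R) (egf a) (egf (fun k => a k.+1) t).
Proof.
move=> aK; rewrite /egf -pseries_diffs_egf.
apply: (@pseries_snd_diffs _ _ (`|t| + 1)).
- exact: is_cvg_egf aK.
- rewrite pseries_diffs_egf; apply: (is_cvg_egf (C := C * K) (K := K)) => k.
  by rewrite -mulrA -exprS.
- rewrite !pseries_diffs_egf; apply: (is_cvg_egf (C := C * K * K) (K := K)) => k.
  by rewrite -!mulrA -!exprS.
by rewrite [ltRHS]ger0_norm ?ltrDl// addr_ge0.
Qed.

Lemma egf_lin (a b : R^nat) (C K t u v : R) :
  (forall k, `|a k| <= C * K ^+ k) -> (forall k, `|b k| <= C * K ^+ k) ->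
  egf (fun k => u * a k + v * b k) t = u * egf a t + v * egf b t.
Proof.
move=> aK bK; apply/cvg_lim => //; have ca := is_cvg_egf (t := t) aK.
have cb := is_cvg_egf (t := t) bK.
rewrite (_ : pseries _ t = fun m => u * pseries (fun k => (k`!%:R)^-1 * a k) t m
   + v * pseries (fun k => (k`!%:R)^-1 * b k) t m).
  by apply: cvgD; apply: cvgMl_tmp.
apply/funext => m; rewrite /pseries/series/= !mulr_sumr -big_split/=.
by apply: eq_bigr => k _; ring.
Qed.

Let c := egf (fun k => (cpow k).1).
Let s := egf (fun k => (cpow k).2).
Let M := `|x| + `|y|.

Let aM k : `|(cpow k).1| <= 1 * M ^+ k.
Proof. by rewrite mul1r cpow1_le. Qed.
Let bM k : `|(cpow k).2| <= 1 * M ^+ k.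
Proof. by rewrite mul1r cpow2_le. Qed.

Let dc t : is_derive t (1 : R) c (x * c t - y * s t).
Proof.
have := is_derive_egf t aM; rewrite (_ : egf _ t = x * c t - y * s t)//.
rewrite -mulNr -(egf_lin _ _ _ aM bM); congr egf; apply/funext => k /=.
by case: (cpow k) => a b /=; rewrite mulNr.
Qed.

Let ds t : is_derive t (1 : R) s (x * s t + y * c t).
Proof.
have := is_derive_egf t bM; rewrite (_ : egf _ t = x * s t + y * c t)//.
rewrite -(egf_lin _ _ _ bM aM); congr egf; apply/funext => k /=.
by case: (cpow k) => a b /=.
Qed.

Let egf0 (a : R^nat) : egf a 0 = a 0.
Proof.
apply/cvg_lim => //; apply: cvg_near_cst; near=> m.
rewrite -[m]prednK; last by near: m.
rewrite /pseries/series/= big_nat_recl// big1 ?addr0 => [|i _].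
  by rewrite fact0 invr1 mul1r expr0 mulr1.
by rewrite expr0n mulr0.
Unshelve. all: by end_near.
Qed.

(* Real and imaginary parts of [exp (- (x + i y) t) * (c t + i s t)], which is
   constant. *)
Let phi t := expR (- x * t) * (c t * cos (y * t) + s t * sin (y * t)).
Let psi t := expR (- x * t) * (s t * cos (y * t) - c t * sin (y * t)).

Let dphi t : is_derive t (1 : R) phi 0.
Proof.
have Dc := dc t; have Ds := ds t.
rewrite /phi.
by apply: is_derive_eq; rewrite /GRing.scale/=; ring.
Qed.

Let dpsi t : is_derive t (1 : R) psi 0.
Proof.
have Dc := dc t; have Ds := ds t.
rewrite /psi.
by apply: is_derive_eq; rewrite /GRing.scale/=; ring.
Qed.

(** Euler's formula for the power series of the exponential at [x + i y]. *)
Lemma cvg_cpow :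
  series (fun k => (k`!%:R)^-1 * (cpow k).1) @ \oo --> expR x * cos y /\
  series (fun k => (k`!%:R)^-1 * (cpow k).2) @ \oo --> expR x * sin y.
Proof.
have p1 : phi 1 = phi 0 by apply: (is_derive_0_is_cst).
have q1 : psi 1 = psi 0 by apply: (is_derive_0_is_cst).
move: p1 q1; rewrite /phi /psi !mulr0 !mulr1 expR0 cos0 sin0 /c /s !egf0/= !expRN.
rewrite -/c -/s => p1 q1.
have e0 : expR x != 0 by rewrite gt_eqF ?expR_gt0.
have cs := cos2Dsin2 y.
have p2 : c 1 * cos y + s 1 * sin y = expR x.
  by apply: (mulfI (invr_neq0 e0)); rewrite p1 mulVf//; ring.
have q2 : s 1 * cos y - c 1 * sin y = 0.
  by apply: (mulfI (invr_neq0 e0)); rewrite q1 !mulr0; ring.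
have rot (c1 s1 r : R) :
    c1 * cos y + s1 * sin y = r -> s1 * cos y - c1 * sin y = 0 ->
    r * cos y = c1 /\ r * sin y = s1.
  move=> <- q; split; apply/eqP; rewrite -subr_eq0.
    rewrite -[X in _ - X]mulr1 -cs -(mulr0 (sin y)) -q; apply/eqP; ring.
  rewrite -[X in _ - X]mulr1 -cs -(mulr0 (- cos y)) -q; apply/eqP; ring.
have [-> ->] := rot _ _ _ p2 q2.
have one (a : R^nat) :
    pseries (fun k => (k`!%:R)^-1 * a k) 1 = series (fun k => (k`!%:R)^-1 * a k).
  by apply/funext => m; apply: eq_bigr => k _; rewrite /= expr1n mulr1.
by split; rewrite -one; [exact: is_cvg_egf aM|exact: is_cvg_egf bM].
Qed.

End ComplexExponential.

(** * Uniqueness of the principal logarithm *)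

Section LogUnique.
Variable R : realType.

Lemma cvg_expR_diff (x : R) :
  series (fun k => (k`!%:R)^-1 * (k%:R * x ^+ k.-1)) @ \oo --> expR x.
Proof.
rewrite -cvg_shiftS (_ : (fun _ => _) = series (fun k => (k`!%:R)^-1 * x ^+ k)).
  exact: cvg_expR.
apply/funext => m; rewrite /series/= big_nat_recl//= mul0r mulr0 add0r.
apply: eq_bigr => k _.
by rewrite factS natrM invfM mulrACA /= mulVf ?pnatr_eq0// mul1r.
Qed.

(** The real form of [v *m expmx X = e^z v] for a complex eigenvector
[v = u + i w] with eigenvalue [z = x + i y]. *)
Lemma row_expmx_rot n (u w : 'rV[R]_n) (X : 'M[R]_n) (x y : R) :
  u *m X = x *: u - y *: w -> w *m X = x *: w + y *: u ->
  u *m expmx X = (expR x * cos y) *: u - (expR x * sin y) *: w /\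
  w *m expmx X = (expR x * cos y) *: w + (expR x * sin y) *: u.
Proof.
move=> uX wX.
have uwX k : u *m X ^+ k = (cpow x y k).1 *: u - (cpow x y k).2 *: w /\
    w *m X ^+ k = (cpow x y k).1 *: w + (cpow x y k).2 *: u.
  elim: k => [|k [IHu IHw]] /=.
    by rewrite expr0 !mulmx1 !scale1r !scale0r subr0 addr0.
  rewrite exprSr -[_ * _]/(_ *m _) !mulmxA IHu IHw; case: (cpow x y k) => a b /=.
  rewrite mulmxBl mulmxDl -!scalemxAl uX wX.
  by split; apply/rowP => j; rewrite !mxE; ring.
have [cvc cvs] := cvg_cpow x y.
split; apply: row_expmx_unique => j; rewrite !mxE.
- rewrite (_ : series _ = fun m =>
      series (fun k => (k`!%:R)^-1 * (cpow x y k).1) m * u 0 j -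
      series (fun k => (k`!%:R)^-1 * (cpow x y k).2) m * w 0 j).
    by apply: cvgB; apply: cvgMr_tmp.
  apply/funext => m; rewrite /series/= !mulr_suml -sumrB; apply: eq_bigr => k _.
  by rewrite (uwX k).1 !mxE; ring.
- rewrite (_ : series _ = fun m =>
      series (fun k => (k`!%:R)^-1 * (cpow x y k).1) m * w 0 j +
      series (fun k => (k`!%:R)^-1 * (cpow x y k).2) m * u 0 j).
    by apply: cvgD; apply: cvgMr_tmp.
  apply/funext => m; rewrite /series/= !mulr_suml -big_split; apply: eq_bigr => k _.
  by rewrite (uwX k).2 !mxE /=; ring.
Qed.

(** Here [u] is a generalised eigenvector of rank two, so that
[u *m X ^+ k = x^k u + k x^(k-1) w]. *)
Lemma row_expmx_jordan n (u w : 'rV[R]_n) (X : 'M[R]_n) (x : R) :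
  u *m X = x *: u + w -> w *m X = x *: w ->
  u *m expmx X = expR x *: (u + w).
Proof.
move=> uX wX.
have wk k : w *m X ^+ k = x ^+ k *: w.
  elim: k => [|k IH]; first by rewrite !expr0 mulmx1 scale1r.
  by rewrite exprSr -[_ * _]/(_ *m _) mulmxA IH -scalemxAl wX scalerA exprSr.
have uk k : u *m X ^+ k = x ^+ k *: u + (k%:R * x ^+ k.-1) *: w.
  elim: k => [|k IH]; first by rewrite !expr0 mulmx1 scale1r mul0r scale0r addr0.
  rewrite exprS -[_ * _]/(_ *m _) mulmxA uX mulmxDl -scalemxAl IH wk.
  apply/rowP => j; rewrite !mxE exprS -natr1.
  by case: k {IH} => [|k] /=; rewrite ?exprS; ring.
apply: row_expmx_unique => j; rewrite !mxE.
rewrite (_ : series _ = fun m =>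
    series (fun k => (k`!%:R)^-1 * x ^+ k) m * u 0 j +
    series (fun k => (k`!%:R)^-1 * (k%:R * x ^+ k.-1)) m * w 0 j).
  rewrite mulrDr; apply: cvgD; apply: cvgMr_tmp; first exact: cvg_expR.
  exact: cvg_expR_diff.
apply/funext => m; rewrite /series/= !mulr_suml -big_split; apply: eq_bigr => k _.
by rewrite uk !mxE /=; ring.
Qed.

Lemma sin_eq0_lt_pi (y : R) : `|y| < pi -> sin y = 0 -> y = 0.
Proof.
move=> /[!ltr_norml]/andP[yl yu] s0.
have [y0|y0|//] := ltgtP y 0.
- have : 0 < sin (- y) by apply: sin_gt0_pi; rewrite oppr_gt0 y0 ltrNl.
  by rewrite sinN s0 oppr0 ltxx.
- have : 0 < sin y by apply: sin_gt0_pi; rewrite y0.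
  by rewrite s0 ltxx.
Qed.

(** An eigenvalue [x + i y] of [X] in the strip is real when [expmx X] acts on
its eigenvector as a positive scalar: [e^(x + i y) = e^r] leaves only [y = 0]
in the strip. *)
Lemma eigenvalue_exp_real n (u w : 'rV[R]_n) (X : 'M[R]_n) (x y r : R) :
  (u != 0) || (w != 0) -> `|y| < pi ->
  u *m X = x *: u - y *: w -> w *m X = x *: w + y *: u ->
  u *m expmx X = expR r *: u -> w *m expmx X = expR r *: w ->
  x = r /\ y = 0.
Proof.
move=> uw ypi uX wX ur wr; have [] := row_expmx_rot uX wX; rewrite ur wr.
set C := expR x * cos y; set S := expR x * sin y => uC wC.
have zero (a b : R) : (a != 0) || (b != 0) ->
    expR r * a = C * a - S * b -> expR r * b = C * b + S * a -> C = expR r /\ S = 0.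
  move=> ab ea eb.
  have ab0 : 0 < a ^+ 2 + b ^+ 2.
    case/orP: ab => h; [apply: ltr_pwDl|apply: ltr_pwDr]; rewrite ?sqr_ge0//;
    by rewrite lt_def sqr_ge0 sqrf_eq0 h.
  have : ((C - expR r) ^+ 2 + S ^+ 2) * (a ^+ 2 + b ^+ 2) = 0.
    have -> : ((C - expR r) ^+ 2 + S ^+ 2) * (a ^+ 2 + b ^+ 2) =
      (C * a - S * b - expR r * a) ^+ 2 + (C * b + S * a - expR r * b) ^+ 2 by ring.
    by rewrite -ea -eb !subrr expr0n addr0.
  move/eqP; rewrite mulf_eq0 (gt_eqF ab0) orbF paddr_eq0 ?sqr_ge0//.
  by rewrite !sqrf_eq0 subr_eq0 => /andP[/eqP-> /eqP->].
have [Cr S0] : C = expR r /\ S = 0.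
  have [j uwj] : exists j, (u 0 j != 0) || (w 0 j != 0).
    case/orP: uw => /rV0Pn[j hj]; exists j; rewrite hj ?orbT//.
  apply: (zero _ _ uwj); first by move/rowP/(_ j): uC; rewrite !mxE.
  by move/rowP/(_ j): wC; rewrite !mxE.
have y0 : y = 0.
  apply: sin_eq0_lt_pi => //; apply/eqP; move/eqP: S0.
  by rewrite mulf_eq0 expR_eq0.
by split=> //; apply: expR_inj; rewrite -Cr /C y0 cos0 mulr1.
Qed.

Lemma nilpotent_of_eigenvalues0 n (N : 'M[R]_n) :
  (forall z : R[i], eigenvalue (map_mx (real_complex R) N) z -> z = 0) ->
  N ^+ n = 0.
Proof.
case: n N => [|n] N N0; first by apply/matrixP => -[].
set A := map_mx _ N in N0.
have cp : char_poly A = 'X^(n.+1).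
  have [r pr] := closed_field_poly_normal (char_poly A).
  rewrite (monicP (char_poly_monic A)) scale1r in pr.
  have r0 : all (pred1 0) r.
    apply/allP => z zr; apply/eqP/N0; rewrite eigenvalue_root_char pr.
    by rewrite root_prod_XsubC.
  have sr : size r = n.+1.
    by have := size_char_poly A; rewrite pr size_prod_XsubC => -[].
  rewrite pr (eq_big_seq (fun _ => 'X)).
    by rewrite big_const_seq count_predT sr iter_mulr_1.
  by move=> z /(allP r0)/eqP ->; rewrite subr0.
have A0 : A ^+ n.+1 = 0.
  by have := Cayley_Hamilton A; rewrite cp rmorphXn/= horner_mx_X.
apply: (map_mx_inj (f := real_complex R)).
by rewrite map_mx0 -A0 /A rmorphXn.
Qed.

(** The spectral projection of [diag_mx l] for the value [x]. *)
Definition level_mx n (l : 'rV[R]_n) (x : R) : 'M[R]_n :=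
  diag_mx (\row_j (l 0 j == x)%:R).

(** As [expR] is injective, commuting with [diag_mx (e^l)] already forces [X] to
preserve the blocks on which [l] is constant. *)
Lemma level_mx_comm n (l : 'rV[R]_n) (X : 'M[R]_n) x :
  comm_mx X (diag_mx (map_mx (@expR R) l)) ->
  comm_mx X (level_mx l x).
Proof.
move=> /matrixP XA; apply/matrixP => i j; have := XA i j.
rewrite /level_mx !mul_mx_diag !mul_diag_mx !mxE mulrC => /eqP.
rewrite -subr_eq0 -mulrBl mulf_eq0 subr_eq0 => /orP[/eqP/expR_inj ->|/eqP->].
  by rewrite mulrC.
by rewrite mulr0 mul0r.
Qed.

Lemma level_mx_diag n (l : 'rV[R]_n) x :
  level_mx l x *m diag_mx l = x *: level_mx l x.
Proof.
apply/matrixP => i j; rewrite /level_mx mul_diag_mx !mxE.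
have [->|_] := eqVneq i j; rewrite ?mulr1n ?mulr0n ?mulr0//.
by have [->|_] := eqVneq (l 0 j) x; rewrite ?mul1r ?mulr1// mul0r mulr0.
Qed.

Lemma level_mx_expdiag n (l : 'rV[R]_n) x :
  level_mx l x *m diag_mx (map_mx (@expR R) l) = expR x *: level_mx l x.
Proof.
apply/matrixP => i j; rewrite /level_mx mul_diag_mx !mxE.
have [->|_] := eqVneq i j; rewrite ?mulr1n ?mulr0n ?mulr0//.
by have [->|_] := eqVneq (l 0 j) x; rewrite ?mul1r ?mulr1// mul0r mulr0.
Qed.

Lemma mulmx_level n (l v : 'rV[R]_n) x j :
  (v *m level_mx l x) 0 j = v 0 j * (l 0 j == x)%:R.
Proof. by rewrite /level_mx mul_mx_diag !mxE. Qed.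

Lemma eigenvector_ReIm n (X : 'M[R]_n) (v : 'rV[R[i]]_n) (x y : R) :
  v *m map_mx (real_complex R) X = (x +i* y)%C *: v <->
  map_mx (@complex.Re R) v *m X =
    x *: map_mx (@complex.Re R) v - y *: map_mx (@complex.Im R) v /\
  map_mx (@complex.Im R) v *m X =
    x *: map_mx (@complex.Im R) v + y *: map_mx (@complex.Re R) v.
Proof.
have sumRe (F : 'I_n -> R[i]) : complex.Re (\sum_i F i) = \sum_i complex.Re (F i).
  by apply: (big_morph (@complex.Re R)) => // -[a b] [c d].
have sumIm (F : 'I_n -> R[i]) : complex.Im (\sum_i F i) = \sum_i complex.Im (F i).
  by apply: (big_morph (@complex.Im R)) => // -[a b] [c d].
have Re_v j : complex.Re ((v *m map_mx (real_complex R) X) 0 j) =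
    (map_mx (@complex.Re R) v *m X) 0 j.
  rewrite !mxE sumRe; apply: eq_bigr => i _; rewrite !mxE.
  by case: (v 0 i) => a b /=; rewrite mulr0 subr0.
have Im_v j : complex.Im ((v *m map_mx (real_complex R) X) 0 j) =
    (map_mx (@complex.Im R) v *m X) 0 j.
  rewrite !mxE sumIm; apply: eq_bigr => i _; rewrite !mxE.
  by case: (v 0 i) => a b /=; rewrite mulr0 add0r.
split=> [vX | [uX wX]].
  split; apply/rowP => j; rewrite -?Re_v -?Im_v vX !mxE.
  - by case: (v 0 j).
  - by case: (v 0 j) => a b /=; ring.
apply/rowP => j; apply/eqP; rewrite eq_complex Re_v Im_v uX wX !mxE.
by case: (v 0 j) => a b /=; rewrite eqxx; apply/eqP; ring.
Qed.

(** With [N = X - diag_mx l], which commutes with every projection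
[level_mx l x]: the strip condition makes all eigenvalues of [N] vanish, so [N]
is nilpotent, and [expmx X] being diagonal excludes Jordan blocks, so [N = 0]. *)
Lemma principal_log_diag_unique n (X : 'M[R]_n) (l : 'rV[R]_n) :
  is_principal_log (diag_mx (map_mx (@expR R) l)) X -> X = diag_mx l.
Proof.
move=> [Xl strip].
have XE x : X *m level_mx l x = level_mx l x *m X.
  by apply: level_mx_comm; rewrite /comm_mx -Xl expmx_comm.
pose N := X - diag_mx l.
have NE x : N *m level_mx l x = level_mx l x *m N.
  by rewrite mulmxBl mulmxBr XE /level_mx (diag_mxC l).
have levX x (v : 'rV[R]_n) : v *m level_mx l x *m X =
    x *: (v *m level_mx l x) + v *m N *m level_mx l x.
  rewrite -(mulmxA _ N) NE -{1}[X](subrK (diag_mx l)) -/N addrC !mulmxDr -!mulmxA.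
  by rewrite level_mx_diag -scalemxAr.
have levexp x (v : 'rV[R]_n) : v *m level_mx l x *m expmx X =
    expR x *: (v *m level_mx l x).
  by rewrite Xl -mulmxA level_mx_expdiag -scalemxAr.
(* A pair [v], [v N] with [v N != 0 = v N N] is projected to one block, where
   [expmx X] acts as a scalar but sends [v] to a multiple of [v + v N]. *)
have noJ (v : 'rV[R]_n) : v *m N *m N = 0 -> v *m N = 0.
  move=> vNN; apply/rowP => j; rewrite [RHS]mxE.
  set x := l 0 j.
  have := @row_expmx_jordan _ (v *m level_mx l x) (v *m N *m level_mx l x) X x.
  rewrite levX => /(_ erefl); rewrite levX vNN mul0mx addr0 => /(_ erefl).
  rewrite levexp => /(scalerI (lt0r_neq0 (expR_gt0 x)))/rowP/(_ j).
  by rewrite [RHS]mxE -{1}[LHS]addr0 => /addrI; rewrite mulmx_level eqxx mulr1.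
have NnilX : N ^+ n = 0.
  apply: nilpotent_of_eigenvalues0 => z /eigenvalueP[v vN v0].
  case: z vN => x y /eigenvector_ReIm[].
  set u := map_mx (@complex.Re R) v; set w := map_mx (@complex.Im R) v => uN wN.
  have [j vj0] : exists j, v 0 j != 0 by exact/rV0Pn.
  have uwj : (u 0 j != 0) || (w 0 j != 0).
    rewrite !mxE; move: vj0; case: (v 0 j) => a b /=.
    by rewrite eq_complex negb_and.
  set t := l 0 j; pose u' := u *m level_mx l t; pose w' := w *m level_mx l t.
  have u'X : u' *m X = (t + x) *: u' - y *: w'.
    by rewrite levX uN mulmxBl -!scalemxAl addrA -scalerDl.
  have w'X : w' *m X = (t + x) *: w' + y *: u'.
    by rewrite levX wN mulmxDl -!scalemxAl addrA -scalerDl.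
  have uw'0 : (u' != 0) || (w' != 0).
    case/orP: uwj => h; apply/orP; [left|right]; apply/rV0Pn; exists j;
    by rewrite mulmx_level eqxx mulr1.
  have ypi : `|y| < pi.
    apply: (strip ((t + x) +i* y)%C); apply/eigenvalueP.
    pose v' : 'rV[R[i]]_n := \row_j (u' 0 j +i* w' 0 j)%C.
    have Rv' : map_mx (@complex.Re R) v' = u' by apply/rowP => k; rewrite !mxE.
    have Iv' : map_mx (@complex.Im R) v' = w' by apply/rowP => k; rewrite !mxE.
    exists v'; first by apply/eigenvector_ReIm; rewrite Rv' Iv'.
    apply: contraTneq uw'0 => v'0; rewrite -Rv' -Iv' v'0 negb_or !negbK.
    by apply/andP; split; apply/eqP/rowP => k; rewrite !mxE.
  have [tx ->] := eigenvalue_exp_real uw'0 ypi u'X w'X (levexp _ _) (levexp _ _).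
  by have -> : x = 0 by lra.
have {}Nnil k : N ^+ k.+1 = 0 -> N = 0.
  elim: k => [|k IH]; first by rewrite expr1.
  move=> Nk; apply: IH; apply/row_matrixP => i.
  rewrite row0 rowE exprSr -[_ * _]/(_ *m _) mulmxA; apply: noJ.
  rewrite -!mulmxA -[N *m N]/(N * N) -expr2 -[N ^+ k *m _]/(_ * _) -exprD addn2 Nk.
  by rewrite mulmx0.
apply/eqP; rewrite -subr_eq0 -/N; apply/eqP/(Nnil n).
by rewrite exprS NnilX mulr0.
Qed.

End LogUnique.

(** * Square root, logarithm and deviator of diagonalised matrices *)

Section Spectral.
Variable R : realType.

Lemma principal_log_conj n (P Q A X : 'M[R]_n) : Q *m P = 1%:M ->
  is_principal_log A X -> is_principal_log (P *m A *m Q) (P *m X *m Q).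
Proof.
move=> QP [XA strip]; split; first by rewrite expmx_conj// XA.
move=> z /eigenvalueP[v vX v0]; apply: strip; apply/eigenvalueP.
have PQ := mulmx1C QP.
exists (v *m map_mx (real_complex R) P).
  rewrite scalemxAl -vX !map_mxM !mulmxA -[in RHS]mulmxA -map_mxM QP map_mx1.
  by rewrite mulmx1.
apply: contra_neq v0 => vP; rewrite -[v]mulmx1 -(map_mx1 (real_complex R)) -PQ.
by rewrite map_mxM mulmxA vP mul0mx.
Qed.

Lemma principal_log_diag n (l : 'rV[R]_n) :
  is_principal_log (diag_mx (map_mx (@expR R) l)) (diag_mx l).
Proof.
split; first exact: expmx_diag.
move=> z /eigenvalueP[v vX /rV0Pn[j vj]].
have /eqP := congr1 (fun u : 'rV_n => u 0 j) vX.
rewrite map_diag_mx mul_mx_diag !mxE -subr_eq0 mulrC -mulrBl mulf_eq0.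
rewrite (negbTE vj) orbF subr_eq0 => /eqP <- /=.
by rewrite normr0 pi_gt0.
Qed.

Lemma logmx_conj_diag n (P Q : 'M[R]_n) (l : 'rV[R]_n) : Q *m P = 1%:M ->
  logmx (P *m diag_mx (map_mx (@expR R) l) *m Q) = P *m diag_mx l *m Q.
Proof.
move=> QP; have PQ := mulmx1C QP; apply: xget_unique => /=.
  exact/principal_log_conj/principal_log_diag.
move=> X /(principal_log_conj PQ); rewrite !mulmxA QP mul1mx -mulmxA QP mulmx1.
by move/principal_log_diag_unique <-; rewrite !mulmxA PQ mul1mx -mulmxA PQ mulmx1.
Qed.

Lemma quad_ge0 n (S : 'M[R]_n) (x : 'cV[R]_n) : posdefmx S ->
  0 <= (x^T *m S *m x) 0 0 ?= iff (x == 0).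
Proof.
move=> [_ Spos]; have [->|x0] := eqVneq x 0.
  by rewrite mulmx0 mxE; apply/leifP.
by apply/leifP/Spos.
Qed.

(** With [D = S - T], the equation [S S = T T] gives [S D + D T = 0]; hence the
nonnegative numbers [tr (D S D)] and [tr (D T D)] have sum zero, and [D = 0]
because [S] is definite. *)
Lemma posdef_sqrt_unique n (S T : 'M[R]_n) :
  posdefmx S -> posdefmx T -> S *m S = T *m T -> S = T.
Proof.
move=> Sp Tp ST; pose D := S - T.
have DT : D^T = D by rewrite /D linearB /= Sp.1 Tp.1.
have trE (A : 'M[R]_n) :
    \tr (D *m A *m D) = \sum_i ((col i D)^T *m A *m col i D) 0 0.
  apply: eq_bigr => i _; rewrite tr_col DT.
  rewrite -row_mul [LHS]mxE [RHS]mxE; apply: eq_bigr => k _.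
  by rewrite [row _ _ _ _]mxE [col _ _ _ _]mxE.
have z : \tr (D *m S *m D) + \tr (D *m T *m D) = 0.
  have -> : \tr (D *m T *m D) = \tr (D *m (D *m T)) by rewrite mxtrace_mulC.
  have SDT : S *m D + D *m T = 0.
    by rewrite /D mulmxBr mulmxBl ST addrA subrK subrr.
  by rewrite -mulmxA -raddfD/= -mulmxDr SDT mulmx0 raddf0.
have ge A : posdefmx A -> 0 <= \tr (D *m A *m D).
  by move=> Ap; rewrite trE; apply: sumr_ge0 => i _; rewrite (quad_ge0 _ Ap).
move/eqP: z; rewrite paddr_eq0 ?ge// => /andP[/eqP + _].
rewrite trE => /psumr_eq0P z; apply/eqP; rewrite -subr_eq0; apply/eqP/matrixP => i j.
have /eqP := z (fun i _ => (quad_ge0 _ Sp).1) j isT.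
by rewrite eq_sym (quad_ge0 _ Sp) => /eqP/colP/(_ i); rewrite !mxE.
Qed.

Lemma posdef_orth_diag n (P : 'M[R]_n) (d : 'rV[R]_n) :
  P *m P^T = 1%:M -> (forall i, 0 < d 0 i) -> posdefmx (P *m diag_mx d *m P^T).
Proof.
move=> PP d0; split; first by rewrite !trmx_mul trmxK tr_diag_mx mulmxA.
move=> x x0; pose y := P^T *m x.
have y0 : y != 0.
  by apply: contra_neq x0 => y0; rewrite -[x]mul1mx -PP -mulmxA -/y y0 mulmx0.
rewrite (_ : x^T *m _ *m x = y^T *m diag_mx d *m y); last first.
  by rewrite /y trmx_mul trmxK !mulmxA.
clearbody y.
have [j yj] : exists j, y j 0 != 0.
  by have /matrix0Pn[j [k yj]] := y0; exists j; rewrite (ord1 k) in yj.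
rewrite mxE (bigD1 j)//= mul_mx_diag !mxE.
have sq i : y i 0 * d 0 i * y i 0 = d 0 i * y i 0 ^+ 2 by ring.
apply: ltr_pwDl.
  by rewrite sq mulr_gt0// lt_def sqr_ge0 sqrf_eq0 yj.
by apply: sumr_ge0 => i _; rewrite !mxE sq mulr_ge0 ?sqr_ge0// ltW.
Qed.

Lemma left_stretch_orth_diag n (F P : 'M[R]_n) (l : 'rV[R]_n) :
  P *m P^T = 1%:M ->
  F *m F^T = P *m diag_mx (map_mx (fun t => expR t ^+ 2) l) *m P^T ->
  left_stretch F = P *m diag_mx (map_mx (@expR R) l) *m P^T.
Proof.
move=> PP FF; have PTP := mulmx1C PP.
set V := P *m _ *m _.
have Vp : posdefmx V by apply: posdef_orth_diag => // i; rewrite mxE expR_gt0.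
have VV : V *m V = F *m F^T.
  rewrite FF /V !mulmxA -(mulmxA _ P^T P) PTP mulmx1 -(mulmxA P) mulmx_diag.
  by congr (_ *m diag_mx _ *m _); apply/rowP => j; rewrite !mxE expr2.
apply: xget_unique => //= S [Sp SS]; apply: posdef_sqrt_unique => //.
by rewrite SS.
Qed.

Lemma frobenius_dev_orth_diag n (P : 'M[R]_n) (l : 'rV[R]_n) :
  (0 < n)%N -> P *m P^T = 1%:M ->
  frobenius_sq (devmx (P *m diag_mx l *m P^T)) =
  \sum_i l 0 i ^+ 2 - (\sum_i l 0 i) ^+ 2 / n%:R.
Proof.
move=> n_gt0 PP; have PTP := mulmx1C PP.
have trl : \tr (P *m diag_mx l *m P^T) = \sum_i l 0 i.
  by rewrite mxtrace_mulC mulmxA PTP mul1mx mxtrace_diag.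
rewrite /devmx trl; set c := _^-1 * _.
have -> : P *m diag_mx l *m P^T - c%:M = P *m diag_mx (\row_i (l 0 i - c)) *m P^T.
  have -> : diag_mx (\row_i (l 0 i - c)) = diag_mx l - c%:M.
    apply/matrixP => i j; rewrite !mxE.
    by have [->|_] := eqVneq i j; rewrite ?mulr1n ?mulr0n ?subr0.
  by rewrite mulmxBr mulmxBl mul_mx_scalar -scalemxAl PP scalemx1.
rewrite /frobenius_sq !trmx_mul trmxK tr_diag_mx !mulmxA -(mulmxA _ P^T P) PTP.
rewrite mulmx1 mxtrace_mulC !mulmxA PTP mul1mx mulmx_diag mxtrace_diag.
have n0 : n%:R != 0 :> R by rewrite pnatr_eq0 -lt0n.
under eq_bigr do rewrite !mxE.
rewrite (eq_bigr (fun i => l 0 i ^+ 2 - (c *+ 2) * l 0 i + c ^+ 2));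
  last by move=> i _; ring.
rewrite big_split/= sumrB -mulr_sumr sumr_const card_ord /c -mulr_natr.
by field.
Qed.

End Spectral.

(** * Spectral theorem for symmetric 2 x 2 matrices *)

Section Plane.
Variable R : realType.

Definition mx2 (a b c d : R) : 'M[R]_2 :=
  \matrix_(i, j) if i == 0 then if j == 0 then a else b
                 else if j == 0 then c else d.

Lemma mx2_eq (a b c d a' b' c' d' : R) :
  a = a' -> b = b' -> c = c' -> d = d' -> mx2 a b c d = mx2 a' b' c' d'.
Proof. by move=> -> -> -> ->. Qed.

Lemma mx2E (A : 'M[R]_2) : A = mx2 (A 0 0) (A 0 1) (A 1 0) (A 1 1).
Proof.
apply/matrixP => i j; rewrite mxE.
by case: i => -[|[|//]] ?; case: j => -[|[|//]] ? /=; congr (A _ _); apply: val_inj.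
Qed.

Lemma mul_mx2 (a b c d a' b' c' d' : R) :
  mx2 a b c d *m mx2 a' b' c' d' =
  mx2 (a * a' + b * c') (a * b' + b * d') (c * a' + d * c') (c * b' + d * d').
Proof.
rewrite [LHS]mx2E; apply: mx2_eq;
by rewrite !mxE !big_ord_recl big_ord0 !mxE /= addr0.
Qed.

Lemma tr_mx2 (a b c d : R) : (mx2 a b c d)^T = mx2 a c b d.
Proof. by rewrite [LHS]mx2E; apply: mx2_eq; rewrite !mxE. Qed.

Lemma scalar_mx2 (a : R) : a%:M = mx2 a 0 0 a.
Proof. by rewrite [LHS]mx2E; apply: mx2_eq; rewrite !mxE. Qed.

Definition row2 (a b : R) : 'rV[R]_2 := \row_j if j == 0 then a else b.

Lemma diag_row2 (a b : R) : diag_mx (row2 a b) = mx2 a 0 0 b.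
Proof. by rewrite [LHS]mx2E; apply: mx2_eq; rewrite !mxE. Qed.

Lemma det_mx2 (a b c d : R) : \det (mx2 a b c d) = a * d - b * c.
Proof.
rewrite (expand_det_row _ 0) !big_ord_recl big_ord0 /cofactor !det_mx11 !mxE /=.
by rewrite !expr0 /bump /= expr1; ring.
Qed.

Lemma sym_mx2_spectral (a c d : R) : exists (P : 'M[R]_2) (x y : R),
  P *m P^T = 1%:M /\ mx2 a c c d = P *m mx2 x 0 0 y *m P^T /\
  x + y = a + d /\ x * y = a * d - c ^+ 2.
Proof.
have [->|c0] := eqVneq c 0.
  exists 1%:M, a, d; rewrite trmx1 !mul1mx mulmx1.
  split=> //; split=> //; split=> //.
  by rewrite expr0n subr0.
pose r := Num.sqrt ((a - d) ^+ 2 + 4 * c ^+ 2).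
have r2 : r ^+ 2 = (a - d) ^+ 2 + 4 * c ^+ 2.
  by rewrite sqr_sqrtr//; have := sqr_ge0 (a - d); have := sqr_ge0 c; lra.
pose x := (a + d + r) / 2; pose y := (a + d - r) / 2.
have xy : x * y = a * d - c ^+ 2.
  have -> : x * y = ((a + d) ^+ 2 - r ^+ 2) / 4 by rewrite /x /y; field.
  by rewrite r2; field.
have yE : y = a + d - x by rewrite /x /y; field.
have ex : (a - x) * (d - x) = c ^+ 2 by rewrite yE in xy; lra.
clearbody x y.
pose h := Num.sqrt (c ^+ 2 + (x - a) ^+ 2).
have c2 : 0 < c ^+ 2 by rewrite lt_def sqr_ge0 sqrf_eq0 c0.
have h2 : h ^+ 2 = c ^+ 2 + (x - a) ^+ 2 by rewrite sqr_sqrtr// addr_ge0 ?sqr_ge0.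
have h0 : h != 0 by rewrite -sqrf_eq0 h2 gt_eqF// ltr_pwDl// sqr_ge0.
(* The column (c, x - a) is an eigenvector for x; (x - a, - c) is orthogonal to
   it. *)
pose P := mx2 (c / h) ((x - a) / h) ((x - a) / h) (- c / h).
have PT : P^T = P by rewrite tr_mx2.
have PP : P *m P^T = 1%:M.
  have e : (c / h) * (c / h) + ((x - a) / h) * ((x - a) / h) = 1.
    rewrite (_ : _ + _ = (c ^+ 2 + (x - a) ^+ 2) / h ^+ 2); last by field.
    by rewrite -h2 mulfV// sqrf_eq0.
  rewrite PT mul_mx2 scalar_mx2; apply: mx2_eq => //; [by field|by field|].
  by rewrite -e; field.
exists P, x, y; split=> //; split; last by split=> //; rewrite yE; ring.
have ey : (x - a) * y = a * (x - a) - c * c by rewrite yE; lra.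
have ex' : (x - a) * x = c * c + d * (x - a) by lra.
have -> : P *m mx2 x 0 0 y = mx2 a c c d *m P.
  rewrite !mul_mx2; apply: mx2_eq; rewrite ?mulr0 ?addr0 ?add0r.
  - by field.
  - by rewrite mulrAC ey; field.
  - by rewrite mulrAC ex'; field.
  - by rewrite yE; field.
by rewrite -mulmxA PP mulmx1.
Qed.

End Plane.

(** * The line of shears *)

Section ShearLine.
Variable R : realType.
Variables (m : nat) (k c : R).

Notation devlog_sq F := (frobenius_sq (devmx (logmx (left_stretch F)))).

Definition base_mx : 'M[R]_(2 + m) := block_mx 1%:M 0 0 (expR c)%:M.
Definition dir_l : 'cV[R]_(2 + m) := col_mx (row2 1 0)^T 0.
Definition dir_r : 'cV[R]_(2 + m) := col_mx (row2 1 k)^T 0.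

Definition shear_line (t : R) : 'M[R]_(2 + m) :=
  base_mx + t *: (dir_l *m dir_r^T).

Lemma shear_lineE t :
  shear_line t = block_mx (mx2 (1 + t) (t * k) 0 1) 0 0 (expR c)%:M.
Proof.
rewrite /shear_line /base_mx /dir_l /dir_r tr_col_mx trmxK trmx0 mul_col_row.
rewrite !mulmx0 !mul0mx scale_block_mx !scaler0 add_block_mx !addr0.
congr (block_mx _ _ _ _); rewrite scalar_mx2 [RHS]mx2E.
rewrite [LHS]mx2E; apply: mx2_eq; rewrite !mxE !big_ord_recl big_ord0 !mxE /=; ring.
Qed.

Lemma det_shear_line t : \det (shear_line t) = (1 + t) * expR c ^+ m.
Proof. by rewrite shear_lineE det_ublock det_mx2 det_scalar; ring. Qed.

Definition shear_energy (t : R) : R := devlog_sq (shear_line t).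

Lemma frobenius_sq_ge0 n (X : 'M[R]_n) : 0 <= frobenius_sq X.
Proof.
apply: sumr_ge0 => i _; rewrite mxE; apply: sumr_ge0 => j _.
by rewrite mxE -expr2 sqr_ge0.
Qed.

Lemma shear_energy_nneg t : shear_energy t \in `[0, +oo[.
Proof. by rewrite in_itv/= andbT; exact: frobenius_sq_ge0. Qed.

(** The numbers [a] and [b] are the logarithms of the singular values of the
2 x 2 block. The sum of squared deviations from the mean is split into the part
within the group [a, b] and the part between that group and the [m] copies of
[c]. *)
Lemma shear_energyP t : (0 < m)%N -> -1 < t ->
  exists a b : R, [/\ expR a * expR b = 1 + t,
    (expR a - expR b) ^+ 2 = t ^+ 2 * (1 + k ^+ 2) &
    shear_energy t =
    (a - b) ^+ 2 / 2 + m%:R / (2 * (2 + m)%:R) * (a + b - 2 * c) ^+ 2].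
Proof.
move=> m0 t1.
have [P [x [y [PP [GG [xDy xMy]]]]]] :=
  sym_mx2_spectral ((1 + t) ^+ 2 + (t * k) ^+ 2) (t * k) 1.
have xy0 : 0 < x * y by rewrite xMy; nra.
have xDy0 : 0 < x + y by rewrite xDy; nra.
have [x0 y0] : 0 < x /\ 0 < y by split; nra.
pose a := ln x / 2; pose b := ln y / 2.
have ea : expR a ^+ 2 = x by rewrite -expRM_natl mulrC divfK// lnK.
have eb : expR b ^+ 2 = y by rewrite -expRM_natl mulrC divfK// lnK.
have eab : expR a * expR b = 1 + t.
  apply/eqP; rewrite -(@eqrXn2 _ 2)// ?mulr_ge0 ?expR_ge0//; last lra.
  by rewrite exprMn ea eb xMy; apply/eqP; ring.
exists a, b; split=> //.
  rewrite sqrrB ea eb eab addrAC xDy; ring.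
pose Q : 'M[R]_(2 + m) := block_mx P 0 0 1%:M.
have QQ : Q *m Q^T = 1%:M.
  rewrite tr_block_mx mulmx_block !trmx0 !mulmx0 !mul0mx !addr0 !add0r PP trmx1.
  by rewrite mulmx1 -scalar_mx_block.
pose l : 'rV[R]_(2 + m) := row_mx (row2 a b) (const_mx c).
rewrite /shear_energy (left_stretch_orth_diag (P := Q) (l := l))//; last first.
  rewrite shear_lineE !tr_block_mx !mulmx_block !trmx0 !mulmx0 !mul0mx !addr0 !add0r.
  have -> : map_mx (fun t : R => expR t ^+ 2) l =
      row_mx (row2 x y) (const_mx (expR c ^+ 2)).
    rewrite map_row_mx; congr row_mx; apply/rowP => j; rewrite !mxE//.
    by case: ifP.
  rewrite diag_mx_row !mulmx_block !mulmx0 !mul0mx !addr0 !add0r.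
  rewrite trmx1 mul1mx mulmx1 mul0mx diag_row2 -GG tr_mx2 mul_mx2.
  congr (block_mx _ _ _ _); first by apply: mx2_eq; ring.
  by rewrite mulmx1 diag_const_mx tr_scalar_mx -scalar_mxM expr2.
rewrite logmx_conj_diag ?frobenius_dev_orth_diag//; last exact: mulmx1C.
rewrite !big_split_ord/=.
under eq_bigr do rewrite row_mxEl.
under [X in _ + X - _]eq_bigr do rewrite row_mxEr mxE.
under [X in (X + _) ^+ 2]eq_bigr do rewrite row_mxEl.
under [X in (_ + X) ^+ 2]eq_bigr do rewrite row_mxEr mxE.
rewrite !big_ord_recl !big_ord0 !mxE /= !sumr_const !card_ord.
rewrite -[c ^+ 2 *+ m]mulr_natr -[c *+ m]mulr_natr !addr0 natrD.
have n0 : 2 + m%:R != 0 :> R by rewrite -natrD pnatr_eq0.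
by field.
Qed.

Lemma shear_line_chord (W : 'M[R]_(2 + m) -> R) (p s u : R) :
  rank_one_convex W ->
  0 <= p -> p <= 1 -> -1 < s -> -1 < u ->
  W (shear_line (p * s + (1 - p) * u)) <=
  p * W (shear_line s) + (1 - p) * W (shear_line u).
Proof.
move=> Wc p0 p1 s1 u1.
have det0 t : -1 < t -> 0 < \det (shear_line t).
  by move=> t1; rewrite det_shear_line mulr_gt0 ?exprn_gt0 ?expR_gt0//; lra.
have b0 : base_mx = shear_line 0 by rewrite /shear_line scale0r addr0.
have I1 (t : R) : `]-1, +oo[%classic t -> -1 < t by rewrite /= in_itv/= andbT.
have I2 (t : R) : -1 < t -> t \in (`]-1, +oo[%classic : set R).
  by move=> t1; rewrite inE /= in_itv/= t1.
have Ioo : is_interval (`]-1, +oo[%classic : set R) by exact: interval_is_interval.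
have base0 : 0 < \det base_mx by rewrite b0 det0// ltrN10.
have := Wc _ _ _ _ base0 Ioo (fun t It => det0 t (I1 t It)).
by move=> /(_ (Itv01 p0 p1) s u (I2 _ s1) (I2 _ u1)).
Qed.

Lemma shear_energy_chord (Psi : R -> R) (p s u : R) :
  rank_one_convex (fun F : 'M[R]_(2 + m) => Psi (devlog_sq F)) ->
  0 <= p -> p <= 1 -> -1 < s -> -1 < u ->
  Psi (shear_energy (p * s + (1 - p) * u)) <=
  p * Psi (shear_energy s) + (1 - p) * Psi (shear_energy u).
Proof. exact: shear_line_chord. Qed.

End ShearLine.

(** * No strictly monotone function *)

Section Impossibility.
Variable R : realType.
Implicit Types Psi : R -> R.

Notation devlog_sq F := (frobenius_sq (devmx (logmx (left_stretch F)))).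

Lemma convex_comb_lt (p x y z : R) : 0 <= p -> p <= 1 -> x < z -> y < z ->
  p * x + (1 - p) * y < z.
Proof.
move=> p0 p1 xz yz; have [->|pN0] := eqVneq p 0; first by lra.
rewrite -subr_gt0 (_ : _ - _ = p * (z - x) + (1 - p) * (z - y)); last by ring.
apply: ltr_pwDl; first by rewrite mulr_gt0 ?subr_gt0// lt_def pN0.
by rewrite mulr_ge0 ?subr_ge0// ltW.
Qed.

(** On the line with [k = c = 0] the energy vanishes at the identity only, so
[Psi] of the energy has a strict maximum inside a segment. *)
Lemma decreasing_not_rank_one_convex m Psi : (0 < m)%N ->
  {in `[0, +oo[ &, {homo Psi : x y /~ x < y}} ->
  ~ rank_one_convex (fun F : 'M[R]_(2 + m) => Psi (devlog_sq F)).
Proof.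
have [half1 half2] : -1 < - 2^-1 :> R /\ -1 < 2^-1 :> R by split; lra.
have [half3 half4] : 0 <= 2^-1 :> R /\ 2^-1 <= 1 :> R by split; lra.
move=> m0 decr Wc; pose g : R -> R := shear_energy m 0 0.
have kap0 : 0 < m%:R / (2 * (2 + m)%:R) :> R by rewrite divr_gt0 ?mulr_gt0 ?ltr0n.
have E0 : g 0 = 0.
  rewrite /g; have [a [b [ab dab ->]]] := shear_energyP 0 0 m0 (ltrN10 R).
  have /eqP : (expR a - expR b) ^+ 2 = 0 by rewrite dab; ring.
  rewrite sqrf_eq0 subr_eq0 => /eqP/expR_inj eab; rewrite -eab in ab *.
  have a0 : a = 0.
    have : expR (a + a) = 1 by rewrite expRD ab addr0.
    by rewrite -expR0 => /expR_inj; lra.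
  by rewrite a0; ring.
have E1 t : -1 < t -> t != 0 -> 0 < g t.
  move=> t1 t0; have [a [b [ab _]]] := shear_energyP 0 0 m0 t1.
  rewrite -/(g t) => ->.
  rewrite ltr_wpDl ?divr_ge0 ?sqr_ge0//.
  rewrite mulr_gt0// lt_def sqr_ge0 sqrf_eq0 mulr0 subr0 andbT.
  apply: contra t0 => /eqP s0; move: ab; rewrite -expRD s0 expR0.
  by move/eqP; rewrite -subr_eq0 opprD addNKr oppr_eq0.
have P1 t : -1 < t -> t != 0 -> Psi (g t) < Psi (g 0).
  move=> t1 t0; apply: decr; [exact: shear_energy_nneg|exact: shear_energy_nneg|].
  by rewrite E0; exact: E1.
have h0 : (2^-1 : R) != 0 by rewrite invr_eq0.
have A : Psi (g 2^-1) < Psi (g 0) by apply: P1 half2 h0.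
have B : Psi (g (- 2^-1)) < Psi (g 0).
  by apply: P1 half1 _; rewrite oppr_eq0 h0.
have : Psi (g (2^-1 * - 2^-1 + (1 - 2^-1) * 2^-1)) <=
    2^-1 * Psi (g (- 2^-1)) + (1 - 2^-1) * Psi (g 2^-1).
  exact: (shear_energy_chord 0 0 Wc half3 half4 half1 half2).
rewrite (_ : 2^-1 * - 2^-1 + (1 - 2^-1) * 2^-1 = 0); last by field.
by rewrite leNgt (convex_comb_lt half3 half4 B A).
Qed.

Lemma expR_mul_ln2 (p : nat) : expR (p%:R * ln 2) = 2 ^+ p :> R.
Proof. by rewrite expRM_natl lnK// posrE. Qed.

Lemma ltr_expR_ln2 (p : nat) (a b : R) :
  a - b < p%:R * ln 2 -> expR a < 2 ^+ p * expR b.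
Proof. by rewrite -expR_mul_ln2 -expRD ltr_expR => ?; lra. Qed.

Lemma gtr_expR_ln2 (p : nat) (a b : R) :
  p%:R * ln 2 < a - b -> 2 ^+ p * expR b < expR a.
Proof. by rewrite -expR_mul_ln2 -expRD ltr_expR => ?; lra. Qed.

(** At [t = 1] and [k = 32] the singular values have product 2 and squared
difference 1025, which is too large for a ratio below [2 ^ 9]. *)
Lemma product2_spread (x y : R) : 0 < x -> 0 < y -> x * y = 2 ->
  x < 512 * y -> y < 512 * x -> (x - y) ^+ 2 < 1025.
Proof.
wlog xy : x y / y <= x.
  move=> H x0 y0 e1 h1 h2; have [le|/ltW le] := lerP y x; first exact: H.
  by rewrite -sqrrN opprB; apply: H => //; rewrite mulrC.
move=> x0 y0 e h _.
have : x * x < x * (512 * y) by rewrite ltr_pM2l.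
have : y * y <= x * y by rewrite ler_pM2r.
rewrite mulrCA e => h1 h2.
have -> : (x - y) ^+ 2 = x * x + y * y - 2 * (x * y) by ring.
by rewrite e; lra.
Qed.

(** At [t = 3] and [k = 32] they have product 4 and squared difference 9225,
which is too small for a ratio above [2 ^ 12]. *)
Lemma product4_spread (x y : R) : 0 < x -> 0 < y -> x * y = 4 ->
  4096 * y < x -> 9225 < (x - y) ^+ 2.
Proof.
move=> x0 y0 e h.
have : x * (4096 * y) < x * x by rewrite ltr_pM2l.
have : 0 < y * y by rewrite mulr_gt0.
rewrite mulrCA e => h1 h2.
have -> : (x - y) ^+ 2 = x * x + y * y - 2 * (x * y) by ring.
by rewrite e; lra.
Qed.

Lemma log_gap_ge (a b : R) : expR a * expR b = 2 ->
  (expR a - expR b) ^+ 2 = 1025 -> (9 * ln 2) ^+ 2 <= (a - b) ^+ 2.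
Proof.
move=> ab dab; rewrite leNgt; apply/negP => h.
have p9 : 2 ^+ 9 = 512 :> R by ring.
have L0 : 0 <= ln 2 :> R by rewrite ln_ge0// ler1n.
have : `|a - b| < 9 * ln 2.
  rewrite -(@ltr_pXn2r _ 2)// ?nnegrE ?normr_ge0 ?mulr_ge0 ?ler0n//.
  by rewrite real_normK ?num_real.
rewrite ltr_norml => /andP[]; rewrite ltrNl opprB => hb ha.
have := product2_spread (expR_gt0 a) (expR_gt0 b) ab.
rewrite -p9 => /(_ (ltr_expR_ln2 ha) (ltr_expR_ln2 hb)).
by rewrite dab ltxx.
Qed.

Lemma log_gap_le (a b : R) : expR a * expR b = 4 ->
  (expR a - expR b) ^+ 2 = 9225 -> (a - b) ^+ 2 <= (12 * ln 2) ^+ 2.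
Proof.
wlog ba : a b / b <= a.
  move=> H ab dab; have [le|/ltW le] := lerP b a; first exact: H.
  by rewrite -sqrrN opprB; apply: H => //; rewrite 1?mulrC// -sqrrN opprB.
move=> ab dab; rewrite lerXn2r ?nnegrE ?subr_ge0//.
  by rewrite mulr_ge0 ?ler0n ?ln_ge0 ?ler1n.
rewrite leNgt; apply/negP => /gtr_expR_ln2.
have -> : 2 ^+ 12 = 4096 :> R by ring.
move=> /(product4_spread (expR_gt0 a) (expR_gt0 b) ab).
by rewrite dab ltxx.
Qed.

(** The energy at [t = 0, 1, 3] is, up to a common constant and in units of
[(ln 2)^2], equal to [0], at least [81 / 2 + K - q] and at most
[72 + 4 K - 2 q], where [q = 4 K c / ln 2]. The value [q = 36] puts the middle
one on top because [K < 1 / 2]. *)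
Lemma shear_energy_interior_max m : (0 < m)%N -> exists c : R,
  shear_energy m 32 c 0 < shear_energy m 32 c 1 /\
  shear_energy m 32 c 3 < shear_energy m 32 c 1.
Proof.
have [gtN0 gtN1 gtN3] : [/\ -1 < 0 :> R, -1 < 1 :> R & -1 < 3 :> R] by split; lra.
move=> m0; pose K : R := m%:R / (2 * (2 + m)%:R).
have m1 : 1 <= m%:R :> R by rewrite ler1n.
have K0 : 0 < K by rewrite divr_gt0 ?mulr_gt0 ?ltr0n.
have K1 : K < 2^-1 by rewrite ltr_pdivrMr ?natrD; lra.
have L0 : 0 < ln 2 :> R by rewrite ln_gt0// ltr1n.
have e2 : 2 = expR (ln 2) :> R by rewrite lnK// posrE.
have e4 : 4 = expR (2 * ln 2) :> R by rewrite expRM_natl -e2 -natrX.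
have sum (a b t q : R) : expR a * expR b = t -> t = expR q -> a + b = q.
  by move=> <-; rewrite -expRD => /expR_inj.
have E (c : R) : [/\ shear_energy m 32 c 0 = K * (2 * c) ^+ 2,
    (9 * ln 2) ^+ 2 / 2 + K * (ln 2 - 2 * c) ^+ 2 <= shear_energy m 32 c 1 &
    shear_energy m 32 c 3 <= (12 * ln 2) ^+ 2 / 2 + K * (2 * ln 2 - 2 * c) ^+ 2].
  split.
  - have [a [b [ab dab ->]]] := shear_energyP 32 c m0 gtN0; rewrite -/K.
    have /eqP : (expR a - expR b) ^+ 2 = 0 by rewrite dab expr0n mul0r.
    rewrite sqrf_eq0 subr_eq0 => /eqP/expR_inj eab.
    by rewrite (sum _ _ _ 0 ab) ?expR0 ?addr0// eab subrr; ring.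
  - have [a [b [ab dab ->]]] := shear_energyP 32 c m0 gtN1; rewrite -/K.
    have ab2 : expR a * expR b = 2 by rewrite ab; ring.
    rewrite (sum _ _ _ _ ab2 e2) lerD2r ler_pM2r ?invr_gt0//.
    by apply: log_gap_ge => //; rewrite dab; ring.
  - have [a [b [ab dab ->]]] := shear_energyP 32 c m0 gtN3; rewrite -/K.
    have ab4 : expR a * expR b = 4 by rewrite ab; ring.
    rewrite (sum _ _ _ _ ab4 e4) lerD2r ler_pM2r ?invr_gt0//.
    by apply: log_gap_le => //; rewrite dab; ring.
clear sum e2 e4; move: (ln 2) L0 E => L L0 E.
clearbody K; exists (9 * L / K).
have Kc : K * (9 * L / K) = 9 * L by rewrite mulrC divfK// gt_eqF.
have [] := E (9 * L / K); move: (9 * L / K) Kc => c Kc.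
move: (shear_energy m 32 c) => g; clear E m0 m1.
have L2 : 0 < L ^+ 2 by rewrite exprn_gt0.
have KL : K * L ^+ 2 < 2^-1 * L ^+ 2 by rewrite ltr_pM2r.
have KL0 : 0 < K * L ^+ 2 by rewrite mulr_gt0.
have -> : K * (L - 2 * c) ^+ 2 =
    K * L ^+ 2 - 4 * (K * c) * L + K * (2 * c) ^+ 2 by ring.
have -> : K * (2 * L - 2 * c) ^+ 2 =
    4 * (K * L ^+ 2) - 8 * (K * c) * L + K * (2 * c) ^+ 2 by ring.
rewrite Kc; move: (K * L ^+ 2) (K * (2 * c) ^+ 2) KL KL0 => KL2 Kc2 KL KL0.
have -> : 4 * (9 * L) * L = 36 * L ^+ 2 by ring.
have -> : 8 * (9 * L) * L = 72 * L ^+ 2 by ring.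
rewrite !exprMn; move: (L ^+ 2) L2 KL => L2 L20 KL -> h1 h3; clear -h1 h3 L20 KL KL0.
by split; [apply: lt_le_trans h1|apply: le_lt_trans h3 (lt_le_trans _ h1)]; lra.
Qed.

Lemma increasing_not_rank_one_convex m Psi : (0 < m)%N ->
  {in `[0, +oo[ &, {homo Psi : x y / x < y}} ->
  ~ rank_one_convex (fun F : 'M[R]_(2 + m) => Psi (devlog_sq F)).
Proof.
have [third1 third2] : 0 <= 2 / 3 :> R /\ 2 / 3 <= 1 :> R by split; lra.
have [gtN0 gtN3] : -1 < 0 :> R /\ -1 < 3 :> R by split; lra.
move=> m0 incr Wc; have [c [g01 g31]] := shear_energy_interior_max m0.
pose g : R -> R := shear_energy m 32 c.
have P01 : Psi (g 0) < Psi (g 1).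
  by apply: incr g01; exact: shear_energy_nneg.
have P31 : Psi (g 3) < Psi (g 1).
  by apply: incr g31; exact: shear_energy_nneg.
have : Psi (g (2 / 3 * 0 + (1 - 2 / 3) * 3)) <=
    2 / 3 * Psi (g 0) + (1 - 2 / 3) * Psi (g 3).
  exact: (shear_energy_chord 32 c Wc third1 third2 gtN0 gtN3).
rewrite (_ : 2 / 3 * 0 + (1 - 2 / 3) * 3 = 1); last by field.
by rewrite leNgt (convex_comb_lt third1 third2 P01 P31).
Qed.

End Impossibility.

Theorem proposition5p2 (R : realType) (n : nat) (hn : (3 <= n)%N) :
  ~ exists Psi : R -> R,
      strictly_monotone_nneg Psi /\
      rank_one_convex (fun F : 'M[R]_n =>
        Psi (frobenius_sq (devmx (logmx (left_stretch F))))).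
Proof.
have m0 : (0 < n - 2)%N by rewrite subn_gt0.
rewrite -(subnKC (ltnW hn)); move: (n - 2)%N m0 => m m0 [Psi [[incr|decr] Wc]].
- exact: increasing_not_rank_one_convex incr Wc.
- exact: decreasing_not_rank_one_convex decr Wc.
Qed.
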